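(* Let $m\ge 0$ be an integer, let $\mathbb{T}_1=\mathbb{T}_2\subseteq\mathbb{R}$ be the same time scale with forward jump operator $\sigma$, and let $\Lambda^2=\mathbb{T}_1\times\mathbb{T}_2=\{(x,b): x\in\mathbb{T}_1,\ b\in\mathbb{T}_2\}$. Let $P(m,b,x)$ be the polynomial in $b,x$ of degree $2m+1$ defined in the context, regarded as a function of $(x,b)\in\Lambda^2$. Then for every $t\in\mathbb{T}_1$ with $\sigma(t)>t$, $$\frac{\Delta x^{2m+1}}{\Delta x}(t)=\frac{\partial P(m,b,x)}{\Delta x}(m,\sigma(t),t)+\frac{\partial P(m,b,x)}{\Delta b}(m,t,t),$$ where the left-hand side is the delta derivative of $x\mapsto x^{2m+1}$ at $t$, the first term on the right is the delta partial derivative of $P$ with respect to $x$ evaluated at $(x,b)=(t,\sigma(t))$, and the second term is the delta partial derivative of $P$ with respect to $b$ evaluated at $(x,b)=(t,t)$.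
   Context: The polynomial $P$. Define real coefficients $\mathbf{A}_{m,r}$, $0\le r\le m$, recursively (downward in $r$) by $\mathbf{A}_{m,m}=(2m+1)\binom{2m}{m}$ and, for $0\le r<m$, $\mathbf{A}_{m,r}=(2r+1)\binom{2r}{r}\sum_{d=2r+1}^{m}\mathbf{A}_{m,d}\binom{d}{2r+1}\frac{(-1)^{d-1}}{d-r}B_{2d-2r}$, where $B_k$ are the Bernoulli numbers (an empty sum is $0$). For nonnegative integers $b$, $P(m,b,x)=\sum_{k=0}^{b-1}\sum_{r=0}^{m}\mathbf{A}_{m,r}\,k^r(x-k)^r$ with the convention $0^0=1$. This is a polynomial in $x$ and $b$, and for arbitrary real $b,x$ the symbol $P(m,b,x)$ denotes the value of the unique polynomial in $b$ and $x$ that agrees with this sum for all nonnegative integers $b$ and all real $x$. Time scales. A time scale $\mathbb{T}$ is a nonempty closed subset of $\mathbb{R}$; its forward jump operator is $\sigma(t)=\inf\{s\in\mathbb{T}: s>t\}$. For $f:\mathbb{T}\to\mathbb{R}$ and $t$ with $\sigma(t)>t$, the delta derivative is $\frac{\Delta f}{\Delta x}(t)=f^\Delta(t)=\frac{f(\sigma(t))-f(t)}{\sigma(t)-t}$. The delta partial derivative of a function on $\Lambda^2$ with respect to one variable, at a point where that variable equals $t$, is the limit as $s\to t$, $s\in\mathbb{T}$, $s\ne\sigma(t)$ (with $s=t$ allowed), of the difference between the values of the function with that variable set to $\sigma(t)$ and to $s$, divided by $\sigma(t)-s$, the other variable being held fixed. Thus, when $\sigma(t)>t$, $\frac{\partial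 P(m,b,x)}{\Delta x}(m,c,t)=\frac{P(m,c,\sigma(t))-P(m,c,t)}{\sigma(t)-t}$ and $\frac{\partial P(m,b,x)}{\Delta b}(m,t,c)=\frac{P(m,\sigma(t),c)-P(m,t,c)}{\sigma(t)-t}$. Arguments are always listed in the order $(m,b,x)$. *)

(* Defs.v *)
From HB Require Import structures.
From mathcomp Require Import all_boot all_order all_algebra.
From mathcomp Require Import all_classical all_reals all_analysis.
From mathcomp Require Import ring.

Set Implicit Arguments.
Unset Strict Implicit.
Unset Printing Implicit Defensive.

Import Order.TTheory GRing.Theory Num.Theory.
Import numFieldNormedType.Exports.

Local Open Scope classical_set_scope.
Local Open Scope ring_scope.

Section Polynomial.
Variable R : realType.
Implicit Types (m n r : nat) (b x : R).

(* [:: B_0; ...; B_(n-1)], with the convention B_1 = - 1/2. *)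
Fixpoint bernoulli_seq n : seq R :=
  if n is n'.+1 then
    rcons (bernoulli_seq n')
      ((n' == 0)%:R -
       (n'.+1%:R)^-1 *
       \sum_(k < n') 'C(n'.+1, k)%:R * (bernoulli_seq n')`_k)
  else [::].

Definition bernoulli n : R := (bernoulli_seq n.+1)`_n.

Lemma size_bernoulli_seq n : size (bernoulli_seq n) = n.
Proof. by elim: n => //= n IHn; rewrite size_rcons IHn. Qed.

Lemma nth_bernoulli_seq n k : (k < n)%N -> (bernoulli_seq n)`_k = bernoulli k.
Proof.
elim: n => // n IHn; rewrite ltnS leq_eqVlt => /predU1P[-> //|lt_kn].
by rewrite /= nth_rcons size_bernoulli_seq lt_kn IHn.
Qed.

Lemma bernoulliE n : bernoulli n =
  (n == 0)%:R - (n.+1%:R)^-1 * \sum_(k < n) 'C(n.+1, k)%:R * bernoulli k.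
Proof.
rewrite {1}/bernoulli /= nth_rcons size_bernoulli_seq ltnn eqxx.
by under eq_bigr do rewrite nth_bernoulli_seq //.
Qed.

Lemma bernoulli_sum n :
  \sum_(k < n.+1) 'C(n.+1, k)%:R * bernoulli k = (n == 0)%:R.
Proof.
rewrite big_ord_recr /= binSn [X in _ + _ * X]bernoulliE mulrBr.
rewrite mulVKf ?pnatr_eq0// addrC subrK.
by case: n => [|n]; rewrite ?mulr1 // mulr0.
Qed.

(* [:: A_(m,m); A_(m,m-1); ...] of length n: the recursion runs downward in
   the second index, so A_(m,d) sits at position m - d. *)
Fixpoint coefA_seq m n : seq R :=
  if n is n'.+1 then
    let s := coefA_seq m n' in
    let r := (m - n')%N in
    rcons s
      (if n' == 0 then ((2 * m).+1 * 'C(2 * m, m))%:R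
       else ((2 * r).+1 * 'C(2 * r, r))%:R *
            \sum_((2 * r).+1 <= d < m.+1)
              s`_(m - d) * 'C(d, (2 * r).+1)%:R *
              ((-1) ^+ d.-1 / (d - r)%:R) * bernoulli (2 * d - 2 * r))
  else [::].

Definition coefA m r : R := (coefA_seq m (m - r).+1)`_(m - r).

Lemma size_coefA_seq m n : size (coefA_seq m n) = n.
Proof. by elim: n => //= n IHn; rewrite size_rcons IHn. Qed.

Lemma nth_coefA_seq m n r :
  (r <= m)%N -> (m - r < n)%N -> (coefA_seq m n)`_(m - r) = coefA m r.
Proof.
move=> le_rm; elim: n => // n IHn; rewrite ltnS leq_eqVlt => /predU1P[<- //|lt_n].
by rewrite /= nth_rcons size_coefA_seq lt_n IHn.
Qed.

Lemma coefA_diag m : coefA m m = ((2 * m).+1 * 'C(2 * m, m))%:R.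
Proof. by rewrite /coefA subnn. Qed.

Lemma coefA_rec m r : (r < m)%N ->
  coefA m r = ((2 * r).+1 * 'C(2 * r, r))%:R *
    \sum_((2 * r).+1 <= d < m.+1)
      coefA m d * 'C(d, (2 * r).+1)%:R *
      ((-1) ^+ d.-1 / (d - r)%:R) * bernoulli (2 * d - 2 * r).
Proof.
move=> lt_rm; rewrite {1}/coefA /= nth_rcons size_coefA_seq ltnn eqxx.
rewrite subn_eq0 leqNgt lt_rm /= subKn 1?ltnW//; congr (_ * _).
rewrite !big_nat; apply: eq_bigr => d /andP[lt_d le_d].
rewrite nth_coefA_seq// ltn_sub2l//.
by apply: leq_ltn_trans lt_d; rewrite mul2n -addnn leq_addr.
Qed.

Definition Psum m n x : R :=
  \sum_(k < n) \sum_(r < m.+1) coefA m r * k%:R ^+ r * (x - k%:R) ^+ r.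

(* Bivariate polynomials are taken in {poly {poly R}}: the outer variable is
   b and the inner one is x. *)
Definition eval2 (p : {poly {poly R}}) b x : R := p.[b%:P].[x].

Definition extends_Psum m : set {poly {poly R}} :=
  [set p | forall n x, eval2 p n%:R x = Psum m n x].

Definition Ppoly m : {poly {poly R}} := xget 0 (extends_Psum m).

Definition P m b x : R := eval2 (Ppoly m) b x.

Lemma power_sum_poly q :
  exists S : {poly R}, forall n, S.[n%:R] = \sum_(k < n) k%:R ^+ q.
Proof.
have [S HS] : exists S : nat -> {poly R}, forall i, (i < q.+1)%N ->
    forall n, (S i).[n%:R] = \sum_(k < n) k%:R ^+ i.
  elim: q.+1 => [|{}q [S HS]]; first by exists (fun=> 0).
  pose Sq := (q.+1%:R)^-1 *: ('X^(q.+1) - \sum_(i < q) 'C(q.+1, i)%:R *: S i).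
  exists (fun i => if i == q then Sq else S i) => i; rewrite ltnS leq_eqVlt.
  case: eqVneq => [-> _ n|_ /= lt_iq]; last exact: HS.
  rewrite /Sq hornerZ hornerD hornerN hornerXn horner_sum.
  apply: (canLR (mulKf _)); first by rewrite pnatr_eq0.
  have -> : n%:R ^+ q.+1 =
      \sum_(k < n) ((k%:R + 1) ^+ q.+1 - k%:R ^+ q.+1) :> R.
    elim: n => [|n IHn]; first by rewrite big_ord0 expr0n.
    by rewrite big_ord_recr -IHn /= natr1 [RHS]addrC subrK.
  under [X in _ - X]eq_bigr => i0 _ do
    rewrite hornerZ HS ?ltn_ord // mulr_sumr.
  rewrite exchange_big -sumrB mulr_sumr; apply: eq_bigr => k _ /=.
  rewrite exprD1n !big_ord_recr /= binn binSn mulr1n addrK addrAC.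
  under eq_bigr do rewrite -mulr_natl.
  by rewrite subrr add0r mulr_natl.
by exists (S q) => n; apply: HS.
Qed.

Lemma extends_Psum_nonempty m : extends_Psum m !=set0.
Proof.
have /choice[S HS] := power_sum_poly.
exists (\sum_(r < m.+1) \sum_(i < r.+1)
  (((coefA m r * (-1) ^+ i) *: 'X^(r - i)) *+ 'C(r, i))%:P
    * map_poly polyC (S (r + i)%N)) => n x.
rewrite /eval2 horner_sum -[_.[x]]/(horner_eval x _) raddf_sum /Psum.
rewrite exchange_big /=; apply: eq_bigr => r _.
rewrite horner_sum raddf_sum /=.
under eq_bigr => i _ do
  rewrite hornerCM horner_map /horner_eval /= hornerM hornerC hornerMn hornerZ
          hornerXn HS mulr_sumr.
rewrite exchange_big /=; apply: eq_bigr => k _.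
rewrite exprDn mulr_sumr; apply: eq_bigr => i _.
rewrite [(- k%:R) ^+ i]exprNn exprD mulrnAr mulrnAl; congr (_ *+ _).
move: (coefA m r) ((-1) ^+ i) (x ^+ (r - i)) (k%:R ^+ r) (k%:R ^+ i).
by move=> a e u v w; ring.
Qed.

Lemma extends_Psum_unique m p q :
  extends_Psum m p -> extends_Psum m q -> p = q.
Proof.
have poly0 (A : idomainType) (f : nat -> A) (s : {poly A}) :
    injective f -> (forall n, s.[f n] = 0) -> s = 0.
  move=> f_inj s0; apply/eqP/contraT => nz_s.
  have := @max_poly_roots _ s (map f (iota 0 (size s))) nz_s.
  rewrite size_map size_iota ltnn; apply.
    by apply/allP => _ /mapP[n _ ->]; apply/rootP.
  by rewrite map_inj_uniq ?iota_uniq.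
have natr_inj : injective (fun n => n%:R : R) by move=> i j /eqP; rewrite eqr_nat => /eqP.
move=> Hp Hq; apply/eqP; rewrite -subr_eq0; apply/eqP.
apply: (poly0 _ (fun n => (n%:R)%:P)) => [|n].
  by move=> i j /polyC_inj /natr_inj.
apply: (poly0 _ (fun n => n%:R)) => // k.
have := Hp n k%:R; rewrite -(Hq n) /eval2 => Epq.
by rewrite !hornerD !hornerN Epq subrr.
Qed.

Lemma PpolyP m : extends_Psum m (Ppoly m).
Proof. by apply: xgetPex; apply: extends_Psum_nonempty. Qed.

End Polynomial.

Section TimeScale.
Variable R : realType.
Implicit Types (T : set R) (t : R).

Definition time_scale T := T !=set0 /\ closed T.

(* The usual convention inf set0 = sup T is made explicit, since the library's
   [inf set0] is 0. Thus sigma T t = t when t is the maximum of T. *)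
Definition sigma T t : R :=
  let S := [set s | T s /\ t < s] in
  if pselect (S !=set0) then inf S else sup T.

Definition delta_quotient T (f : R -> R) t s : R :=
  (f (sigma T t) - f s) / (sigma T t - s).

(* Only meant for points t with t < sigma T t. *)
Definition delta_derive T (f : R -> R) t : R := delta_quotient T f t t.

(* s tends to t within T, avoiding sigma T t; s = t is allowed. *)
Definition delta_nbhs T t : set_system R :=
  within [set s | T s /\ s != sigma T t] (nbhs t).

(* Functions on T1 `*` T2 are taken on R * R, the variables being (x, b). *)
Definition delta_derivable_x T1 (F : R * R -> R) (z : R * R) : Prop :=
  cvg (delta_quotient T1 (fun x => F (x, z.2)) z.1 s @[s --> delta_nbhs T1 z.1]).

Definition delta_partial_x T1 (F : R * R -> R) (z : R * R) : R :=
  lim (delta_quotient T1 (fun x => F (x, z.2)) z.1 s @[s --> delta_nbhs T1 z.1]).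

Definition delta_derivable_b T2 (F : R * R -> R) (z : R * R) : Prop :=
  cvg (delta_quotient T2 (fun b => F (z.1, b)) z.2 s @[s --> delta_nbhs T2 z.2]).

Definition delta_partial_b T2 (F : R * R -> R) (z : R * R) : R :=
  lim (delta_quotient T2 (fun b => F (z.1, b)) z.2 s @[s --> delta_nbhs T2 z.2]).

End TimeScale.

(* Main.v *)
Require Import Defs.
From mathcomp Require Import all_boot all_order all_algebra.
From mathcomp Require Import all_classical all_reals all_analysis.
From mathcomp Require Import ring zify.
Set Implicit Arguments.
Unset Strict Implicit.
Unset Printing Implicit Defensive.
Import Order.TTheory GRing.Theory Num.Theory.
Import numFieldNormedType.Exports.
Local Open Scope classical_set_scope.
Local Open Scope ring_scope.

(** Put s = sigma t. The two partial derivatives share the denominator s - t,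
    and their numerators P(s,s) - P(s,t) and P(s,t) - P(t,t) telescope to
    P(s,s) - P(t,t), so everything reduces to the diagonal identity
    P(m,b,b) = b^(2m+1) ([P_diag]). Both sides being polynomials in b, it is
    enough to take b = n a natural number, that is, to prove ([Psum_diag])
      sum_r A_(m,r) sum_(k < n) k^r (n-k)^r = n^(2m+1).

    The inner sum is computed by the Euler-Maclaurin formula, which is exact on
    polynomials ([euler_maclaurin]), applied to f = X^r (n-X)^r on [0, n]. The
    integral is the Beta integral n^(2r+1) r!^2 / (2r+1)!
    ([beta_integral]). Since f is invariant under X -> n - X, its derivatives
    of even order agree at 0 and n and those of odd order are opposite, so only
    the even-index Bernoulli numbers survive, each multiplied by a Taylor
    coefficient of f at 0. The outcome ([sum_pow_reflect]) is
      n^(2r+1) / ((2r+1) C(2r,r))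
        + (-1)^r sum_l C(r,2l+1) B_(2r-2l) / (r-l) n^(2l+1).
    After summation against A_(m,r), the recursion defining A says exactly that
    the coefficient of n^(2l+1) vanishes for every l < m, while A_(m,m)
    normalizes the coefficient of n^(2m+1) to 1.

    Finally the delta partial derivatives are limits along the time scale; as
    P is polynomial in each variable the quotients are continuous at t, where
    the denominator is s - t > 0, hence the limits exist and are the values of
    the quotients at t ([delta_quotient_cvg]). *)

(** * Polynomials and binomial coefficients *)

Lemma poly_eq_on_nat (R : numDomainType) (p q : {poly R}) :
  (forall n : nat, p.[n%:R] = q.[n%:R]) -> p = q.
Proof.
move=> pq; apply/eqP; rewrite -subr_eq0; apply: contraT => nz_pq.
have := @max_poly_roots _ (p - q) [seq n%:R | n <- iota 0 (size (p - q))] nz_pq.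
rewrite size_map size_iota ltnn; apply.
  by apply/allP => _ /mapP[n _ ->]; rewrite rootE hornerD hornerN pq subrr.
by rewrite map_inj_uniq ?iota_uniq // => i j /eqP; rewrite eqr_nat => /eqP.
Qed.

(** Both products are the trinomial coefficient n! / (i! j! (n-i-j)!). *)
Lemma mul_binC (n i j : nat) : (i + j <= n)%N ->
  ('C(n, i) * 'C(n - i, j) = 'C(n, j) * 'C(n - j, i))%N.
Proof.
move=> le_ij; have le_i : (i <= n)%N by apply: leq_trans le_ij; apply: leq_addr.
have le_j : (j <= n)%N by apply: leq_trans le_ij; apply: leq_addl.
apply/eqP; rewrite -(eqn_pmul2r (fact_gt0 i)) -(eqn_pmul2r (fact_gt0 j)).
rewrite -(eqn_pmul2r (fact_gt0 (n - i - j))); apply/eqP.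
transitivity (n`!).
  by rewrite -(bin_fact le_i) -(@bin_fact (n - i) j) ?leq_subRL //; lia.
rewrite -(bin_fact le_j) -(@bin_fact (n - j) i) ?leq_subRL 1?addnC //.
by rewrite subnAC; lia.
Qed.

(** * The Euler-Maclaurin formula for polynomials *)

Lemma bernoulli0 (R : realType) : bernoulli R 0 = 1.
Proof. by rewrite bernoulliE big_ord0 mulr0 subr0. Qed.

(** Induction on n: expanding (n+1)^(p+1-i) and collecting the powers of n,
    the increment of the right-hand side has as coefficient of n^j the number
    C(p+1,j) times the sum of C(p+1-j,i) B_i over i < p+1-j, which is zero
    unless j = p by the recursion for Bernoulli numbers. *)
Lemma faulhaber (R : realType) (p n : nat) :
  p.+1%:R * \sum_(k < n) (k%:R : R) ^+ p =
  \sum_(i < p.+1) 'C(p.+1, i)%:R * bernoulli R i * n%:R ^+ (p.+1 - i).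
Proof.
elim: n => [|n IHn].
  rewrite big_ord0 mulr0 big1 // => i _.
  by rewrite subSn ?leq_ord // exprS mul0r mulr0.
rewrite big_ord_recr mulrDr IHn /= addrC; apply/esym.
apply/eqP; rewrite -subr_eq -sumrB; apply/eqP/esym.
(* The terms of degree p.+1 - i, excluded from T, cancel in the increment. *)
pose T i j : R := 'C(p.+1, i)%:R * bernoulli R i *
  ('C(p.+1 - i, j)%:R * n%:R ^+ j).
transitivity (\sum_(i < p.+1) \sum_(j < p.+1 | (i + j < p.+1)%N) T i j); last first.
  apply: eq_bigr => i _; rewrite -mulrBr -natr1 exprD1n big_ord_recr /= binn mulr1n.
  rewrite addrK mulr_sumr; transitivity (\sum_(j < p.+1 - i) T i j).
    rewrite (big_ord_widen p.+1 (T i)) ?leq_subr //.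
    by apply: eq_bigl => j; rewrite ltn_subRL.
  by apply: eq_bigr => j _; rewrite /T -(mulr_natl (_ ^+ j)).
rewrite (exchange_big_dep predT) //=.
transitivity (\sum_(j < p.+1) 'C(p.+1, j)%:R * n%:R ^+ j * (p - j == 0)%N%:R : R).
  rewrite big_ord_recr /= subnn eqxx mulr1 binSn big1 ?add0r // => j _.
  by rewrite subn_eq0 leqNgt ltn_ord mulr0.
apply: eq_bigr => j _.
rewrite -bernoulli_sum -subSn ?leq_ord // mulr_sumr.
pose U i := 'C(p.+1, j)%:R * n%:R ^+ j * ('C(p.+1 - j, i)%:R * bernoulli R i).
rewrite (big_ord_widen p.+1 U) ?leq_subr //.
apply: eq_big => [i|i lt_i]; first by rewrite ltn_subRL addnC.
rewrite /T /U.
have le_ij : (i + j <= p.+1)%N by move: lt_i; rewrite ltn_subRL addnC => /ltnW.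
have E : 'C(p.+1, i)%:R * 'C(p.+1 - i, j)%:R =
    'C(p.+1, j)%:R * 'C(p.+1 - j, i)%:R :> R by rewrite -!natrM mul_binC.
by ring: E.
Qed.

(** Euler-Maclaurin for X^p: the q-th bracket is the difference of the q-th
    Taylor coefficients of X^p at n and at 0. The second one, which is
    nonzero for q = p only, removes the constant term that the uniform bound N
    on q would otherwise add. *)
Lemma sum_pow_bernoulli (R : realType) (p N n : nat) : (p < N)%N ->
  \sum_(k < n) (k%:R : R) ^+ p =
  n%:R ^+ p.+1 / p.+1%:R +
  \sum_(q < N) bernoulli R q.+1 / q.+1%:R *
    (n%:R ^+ (p - q) *+ 'C(p, q) - (p == q)%:R).
Proof.
move=> lt_pN; have nz k : k.+1%:R != 0 :> R by rewrite pnatr_eq0.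
apply: (mulfI (nz p)); rewrite faulhaber big_ord_recl bernoulli0 bin0 subn0 !mul1r.
rewrite mulrDr mulrCA divff // mulr1; congr (_ + _).
rewrite mulr_sumr (big_ord_widen N (fun i => 'C(p.+1, i.+1)%:R * bernoulli R i.+1 *
  n%:R ^+ (p.+1 - i.+1))) 1?ltnW // big_mkcond /=.
apply: eq_bigr => q _; case: ltngtP => [lt_qp|lt_pq|->].
- rewrite subr0 subSS -mulr_natr.
  have E : p.+1%:R * 'C(p, q)%:R = q.+1%:R * 'C(p.+1, q.+1)%:R :> R.
    by rewrite -!natrM mul_bin_diag.
  have -> : 'C(p.+1, q.+1)%:R = p.+1%:R * 'C(p, q)%:R / q.+1%:R :> R.
    by rewrite E mulrC mulKf.
  by ring.
- by rewrite bin_small // mulr0n subr0 !mulr0.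
- by rewrite binn subnn expr0 subrr !mulr0.
Qed.

(** The integral of f from 0 to c when size f <= N. Fixing N, rather than
    summing up to size f, makes this manifestly linear in f. *)
Definition integral_upto (R : realType) (N : nat) (c : R) (f : {poly R}) : R :=
  \sum_(p < N) f`_p * (c ^+ p.+1 / p.+1%:R).

(** By linearity it follows from the case of monomials. With divided
    derivatives f^`N(q) = f^(q) / q!, the coefficients B_(q+1) / (q+1)! of the
    usual form become B_(q+1) / (q+1). *)
Lemma euler_maclaurin (R : realType) (f : {poly R}) (N n : nat) :
  (size f <= N)%N ->
  \sum_(k < n) f.[k%:R] = integral_upto N n%:R f +
  \sum_(q < N) bernoulli R q.+1 / q.+1%:R * (f^`N(q).[n%:R] - f`_q).
Proof.
move=> le_fN.
under eq_bigr do rewrite (horner_coef_wide _ le_fN).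
rewrite exchange_big /=.
under eq_bigr => p _ do rewrite -mulr_sumr (@sum_pow_bernoulli _ p N) // mulrDr mulr_sumr.
rewrite big_split /=; congr (_ + _); rewrite exchange_big /=.
apply: eq_bigr => q _.
have defN : f^`N(q).[n%:R] = \sum_(p < N) f`_p * (n%:R ^+ (p - q) *+ 'C(p, q)).
  have {1}-> : f = \sum_(p < N) f`_p *: 'X^p.
    rewrite -poly_def; apply/polyP => i; rewrite coef_poly.
    by case: ltnP => // le_Ni; rewrite nth_default // (leq_trans le_fN).
  rewrite (linear_sum (nderivn q)) horner_sum; apply: eq_bigr => p _.
  by rewrite /= nderivnZ nderivnXn hornerZ hornerMn hornerXn.
have defq : f`_q = \sum_(p < N) f`_p * (p == q :> nat)%:R.
  by rewrite (bigD1 q) //= eqxx mulr1 big1 ?addr0 // => p; rewrite -val_eqE => /negPf /= ->; rewrite mulr0.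
rewrite defN [in RHS]defq -sumrB mulr_sumr; apply: eq_bigr => p _.
by rewrite -mulrBr mulrCA.
Qed.

(** * The polynomial X^r (c - X)^r *)

(** The chain rule contributes a factor -1 per differentiation; it is applied
    to ordinary iterated derivatives and then divided by q!. *)
Lemma nderivn_reflect (R : realType) (c : R) (f : {poly R}) (q : nat) :
  (f \Po (c%:P - 'X))^`N(q) = (-1) ^+ q *: (f^`N(q) \Po (c%:P - 'X)).
Proof.
have D : (f \Po (c%:P - 'X))^`(q) = (-1) ^+ q *: (f^`(q) \Po (c%:P - 'X)).
  elim: q => [|q IHq]; first by rewrite !derivn0 expr0 scale1r.
  rewrite derivnS IHq derivZ deriv_comp derivB derivC derivX sub0r mulrN1.
  by rewrite exprS mulN1r scaleNr scalerN derivnS.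
apply: (@scalerI _ _ (q`!%:R)); first by rewrite pnatr_eq0 -lt0n fact_gt0.
rewrite !scaler_nat -nderivn_def D nderivn_def.
by rewrite -[_ *+ q`!]scaler_nat comp_polyZ !scaler_nat scalerMnr.
Qed.

(** Induction on b, splitting one factor of (c - X)^(b+1) as c - X. *)
Lemma beta_integral (R : realType) (N a b : nat) (c : R) : (a + b < N)%N ->
  integral_upto N c ('X^a * (c%:P - 'X) ^+ b) =
  c ^+ (a + b).+1 * (a`! * b`!)%:R / (a + b).+1`!%:R.
Proof.
have nz k : k.+1%:R != 0 :> R by rewrite pnatr_eq0.
have nzf k : k`!%:R != 0 :> R by rewrite pnatr_eq0 -lt0n fact_gt0.
elim: b a => [|b IHb] a lt_abN.
  rewrite addn0 in lt_abN *; rewrite expr0 mulr1 /integral_upto.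
  rewrite (bigD1 (Ordinal lt_abN)) //= big1 => [|p].
    rewrite coefXn eqxx mul1r addr0 muln1 factS natrM.
    by field; rewrite nzf addrC natr1 nz.
  by rewrite coefXn -val_eqE => /negPf /= ->; rewrite mul0r.
have -> : 'X^a * (c%:P - 'X) ^+ b.+1 =
    c *: ('X^a * (c%:P - 'X) ^+ b) - 'X^(a.+1) * (c%:P - 'X) ^+ b.
  by rewrite -mul_polyC !exprS; ring.
have -> (f g : {poly R}) : integral_upto N c (c *: f - g) =
    c * integral_upto N c f - integral_upto N c g.
  rewrite /integral_upto mulr_sumr -sumrB; apply: eq_bigr => p _.
  by rewrite coefB coefZ mulrBl -mulrA.
rewrite !IHb; [|lia|lia].
rewrite addSn addnS !factS !natrM [c ^+ (a + b).+2]exprS.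
by field; rewrite nzf -!natrD nat1r !pnatr_eq0.
Qed.

Lemma coef_beta (R : comNzRingType) (c : R) (r q : nat) :
  ('X^r * (c%:P - 'X) ^+ r)`_q =
  if (q < r)%N then 0 else (-1) ^+ (q - r) * c ^+ (r - (q - r)) *+ 'C(r, q - r).
Proof.
rewrite coefXnM; case: ifP => // _; move: (q - r)%N => j.
have polyC_signM i k : (-1) ^+ i * c%:P ^+ k = ((-1) ^+ i * c ^+ k)%:P.
  by rewrite polyCM !polyC_exp polyCN polyC1.
rewrite exprBn coef_sum.
under eq_bigr => i _ do rewrite coefMn coefMXn polyC_signM coefC.
case: (leqP j r) => [le_jr|lt_rj].
  have lt_jr : (j < r.+1)%N by [].
  rewrite (bigD1 (Ordinal lt_jr)) //= ltnn subnn big1 ?addr0 // => i ne_ij.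
  case: ltnP => [_|le_ij]; first by rewrite mul0rn.
  by rewrite subn_eq0 leqNgt ltn_neqAle le_ij andbT [_ != _]ne_ij mul0rn.
rewrite bin_small // mulr0n big1 // => i _.
case: ltnP => [_|le_ij]; first by rewrite mul0rn.
by rewrite subn_eq0 leqNgt (leq_trans _ lt_rj) ?ltn_ord // mul0rn.
Qed.

(** * Power sums of k (n - k) *)

Lemma sum_odd_terms (V : nmodType) (g : nat -> V) (r : nat) :
  (forall s, g (2 * s)%N = 0) ->
  \sum_(q < (2 * r).+1) g q = \sum_(s < r) g (2 * s).+1.
Proof.
move=> g0; elim: r => [|r IHr]; first by rewrite big_ord1 big_ord0 (g0 0%N).
rewrite mulnS !addSn add0n 2!big_ord_recr IHr /= [RHS]big_ord_recr /=.
by have := g0 r.+1; rewrite mulnS !addSn add0n => ->; rewrite addr0.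
Qed.

(** Euler-Maclaurin for f = X^r (n-X)^r. By the symmetry of f the q-th boundary
    term carries the factor (-1)^q - 1, so only q = 2(r-l)-1 with 0 <= l < r
    contributes, through the coefficient of X^q in f. *)
Lemma sum_pow_reflect (R : realType) (r n : nat) :
  \sum_(k < n) (k%:R : R) ^+ r * (n%:R - k%:R) ^+ r =
  n%:R ^+ (2 * r).+1 / ((2 * r).+1 * 'C(2 * r, r))%:R +
  \sum_(l < r) (-1) ^+ r * 'C(r, (2 * l).+1)%:R / (r - l)%:R *
    bernoulli R (2 * r - 2 * l) * n%:R ^+ (2 * l).+1.
Proof.
pose f : {poly R} := 'X^r * (n%:R%:P - 'X) ^+ r.
have f_refl : f \Po (n%:R%:P - 'X) = f.
  rewrite /f comp_polyM !rmorphXn /= rmorphB /= comp_polyC comp_polyX.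
  by rewrite subKr mulrC.
have size_f : (size f <= (2 * r).+1)%N.
  apply/leq_sizeP => j lt_j; rewrite coef_beta bin_small ?if_same //; lia.
transitivity (\sum_(k < n) f.[k%:R]).
  by apply: eq_bigr => k _; rewrite /f !hornerE.
rewrite (euler_maclaurin _ size_f); congr (_ + _).
  rewrite beta_integral ?addnn ?mul2n // -mulrA; congr (_ * _).
  have -> : (r.*2.+1`! = (r.*2.+1 * 'C(r.*2, r)) * (r`! * r`!))%N.
    by have := bin_fact (leq_addr r r); rewrite addnK addnn factS => <-; lia.
  rewrite (natrM _ _ (r`! * r`!)) invfM mulrCA divff ?mulr1 //.
(* f^`N(q) at n equals (-1)^q f^`N(q) at 0, which is (-1)^q f`_q. *)
under eq_bigr => q _.
  rewrite -{1}f_refl nderivn_reflect hornerZ horner_comp !hornerE subrr.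
  rewrite horner_coef0 coef_nderivn addn0 binn mulr1n.
  rewrite -[X in _ - X]mul1r -mulrBl.
  over.
rewrite (@sum_odd_terms _ (fun q => bernoulli R q.+1 / q.+1%:R *
  (((-1) ^+ q - 1) * f`_q))) => [|s]; last first.
  by rewrite exprM sqrrN expr1n expr1n subrr mul0r mulr0.
(* Reversing the order makes the exponent of n equal to 2l+1. *)
rewrite (reindex_inj rev_ord_inj) /=; apply: eq_bigr => l _.
have lt_lr := ltn_ord l.
rewrite coef_beta.
have -> : ((2 * (r - l.+1)).+1 = (2 * r - 2 * l).-1)%N by lia.
rewrite prednK; last by lia.
have -> : (-1) ^+ (2 * r - 2 * l).-1 = -1 :> R.
  have -> : ((2 * r - 2 * l).-1 = (2 * (r - l.+1)).+1)%N by lia.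
  by rewrite exprS exprM sqrrN expr1n expr1n mulr1.
have -> : (2 * r - 2 * l)%:R = 2 * (r - l)%:R :> R by rewrite -mulnBr natrM.
have nz : (r - l)%:R != 0 :> R by rewrite pnatr_eq0; lia.
case: leqP => [le_q|lt_q].
  by rewrite bin_small ?mulr0 ?mul0r //; lia.
have -> : ((2 * r - 2 * l).-1 - r = r - (2 * l).+1)%N by lia.
rewrite bin_sub; last by lia.
rewrite subKn; last by lia.
have -> : (-1) ^+ r = - (-1) ^+ (r - (2 * l).+1) :> R.
  have {1}-> : r = ((r - (2 * l).+1) + (2 * l).+1)%N by lia.
  by rewrite exprD exprS exprM sqrrN !expr1n mulr1 mulrN1.
rewrite -mulr_natr; field; exact: nz.
Qed.

(** * The diagonal of P *)

(** Collecting by powers of n, the coefficient of n^(2l+1) is A_(m,l) divided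
    by (2l+1) C(2l,l), plus the sum over r of A_(m,r) g r l; the recursion for
    A_(m,l) makes it zero when l < m. *)
Lemma Psum_diag (R : realType) (m n : nat) :
  Psum m n (n%:R : R) = n%:R ^+ (2 * m).+1.
Proof.
pose D r : R := ((2 * r).+1 * 'C(2 * r, r))%:R.
have nzD r : D r != 0.
  by rewrite pnatr_eq0 -lt0n muln_gt0 /= bin_gt0; lia.
pose g r l : R := (-1) ^+ r * 'C(r, (2 * l).+1)%:R / (r - l)%:R *
    bernoulli R (2 * r - 2 * l).
(* This allows r and l to range independently below m.+1 when the sums are
   exchanged, and then r to be cut back to the range of the recursion. *)
have g0 r l : (r < (2 * l).+1)%N -> g r l = 0.
  by move=> lt_r; rewrite /g bin_small // mulr0 !mul0r.
rewrite /Psum exchange_big /=.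
transitivity (\sum_(l < m.+1) n%:R ^+ (2 * l).+1 *
    (coefA R m l / D l + \sum_(r < m.+1) coefA R m r * g r l)).
  under [RHS]eq_bigr do rewrite mulrDr mulr_sumr.
  rewrite big_split /= [X in _ = _ + X]exchange_big -big_split /=; apply: eq_bigr => r _.
  under eq_bigr do rewrite -mulrA.
  rewrite -mulr_sumr sum_pow_reflect mulrDr; congr (_ + _); first by rewrite mulrCA.
  rewrite (big_ord_widen m.+1 (fun l => g r l * n%:R ^+ (2 * l).+1)); last first.
    exact: ltnW.
  rewrite big_mkcond mulr_sumr; apply: eq_bigr => l _.
  case: ltnP => [_|le_rl]; first by rewrite mulrA mulrC.
  by rewrite g0 ?mulr0 //; lia.
rewrite big_ord_recr /= coefA_diag divff ?nzD //.
have -> : \sum_(r < m.+1) coefA R m r * g r m = 0.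
  by apply: big1 => r _; rewrite g0 ?mulr0 //; have := ltn_ord r; lia.
rewrite addr0 mulr1 big1 ?add0r // => l _.
rewrite coefA_rec // [D l * _]mulrC mulfK //.
rewrite [X in _ + X](_ : _ = - \sum_((2 * l).+1 <= d < m.+1)
      coefA R m d * 'C(d, (2 * l).+1)%:R *
      ((-1) ^+ d.-1 / (d - l)%:R) * bernoulli R (2 * d - 2 * l)).
  by rewrite subrr mulr0.
rewrite -(big_mkord xpredT (fun r => coefA R m r * g r l)).
case: (leqP (2 * l).+1 m.+1) => [le_lm|lt_ml]; last first.
  rewrite [in RHS]big_geq 1?ltnW // oppr0 big_nat big1 // => r /andP[_ lt_r].
  by rewrite g0 ?mulr0 //; lia.
rewrite (big_cat_nat _ le_lm) //= big_nat big1 ?add0r => [|r /andP[_ lt_r]]; last first.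
  by rewrite g0 ?mulr0.
rewrite -sumrN !big_nat; apply: eq_bigr => -[|r] // _.
by rewrite /g exprS /=; ring.
Qed.

Lemma P_diag (R : realType) (m : nat) (b : R) : P m b b = b ^+ (2 * m).+1.
Proof.
have diagE (p : {poly {poly R}}) (c : R) : eval2 p c c = p.['X].[c].
  rewrite /eval2 (horner_coef _ c%:P) (horner_coef _ 'X) !horner_sum; apply: eq_bigr => i _.
  by rewrite !hornerM !horner_exp hornerC hornerX.
rewrite /P diagE -hornerXn; congr (_.[_]); apply: poly_eq_on_nat => n.
by rewrite -diagE PpolyP Psum_diag hornerXn.
Qed.

(** * Delta derivatives *)

Lemma continuous_P_x (R : realType) (m : nat) (b : R) : continuous (P m b).
Proof. exact: continuous_horner. Qed.

Lemma continuous_P_b (R : realType) (m : nat) (x : R) : continuous (P m ^~ x).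
Proof.
have -> : P m ^~ x = horner (map_poly (horner_eval x) (Ppoly R m)).
  apply/funext => b; rewrite /P /eval2.
  by rewrite -[b in RHS](hornerC b x) -[b%:P.[x]]/(horner_eval x b%:P) horner_map.
exact: continuous_horner.
Qed.

(** The point t itself belongs to every set of the filter because
    t != sigma T t. *)
Lemma delta_nbhs_proper (R : realType) (T : set R) (t : R) :
  T t -> t < sigma T t -> ProperFilter (delta_nbhs T t).
Proof.
move=> Tt lt_t; apply: within_nbhs_proper => U /nbhs_singleton Ut.
by exists t; split => //; split => //; rewrite lt_eqF.
Qed.

(** At a right-scattered point the denominator does not tend to 0, so
    continuity of f suffices for delta differentiability. *)
Lemma delta_quotient_cvg (R : realType) (T : set R) (f : R -> R) (t : R) :
  t < sigma T t -> {for t, continuous f} ->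
  delta_quotient T f t s @[s --> delta_nbhs T t] --> delta_quotient T f t t.
Proof.
move=> lt_t cf; apply: cvg_within_filter.
apply: cvgM; first by apply: cvgB; [exact: cvg_cst|exact: cf].
by apply: cvgV; [rewrite subr_eq0 gt_eqF|apply: cvgB; [exact: cvg_cst|exact: cvg_id]].
Qed.

Theorem theorem3p1 (R : realType) (m : nat) (T1 T2 : set R)
    (hT : time_scale T1) (hT12 : T1 = T2) (t : R) (ht : T1 t)
    (hsigma : t < sigma T1 t) :
  let F : R * R -> R := fun z => P m z.2 z.1 in
  [/\ delta_derivable_x T1 F (t, sigma T1 t),
      delta_derivable_b T2 F (t, t) &
      delta_derive T1 (fun x => x ^+ (2 * m).+1) t =
        delta_partial_x T1 F (t, sigma T1 t) + delta_partial_b T2 F (t, t)].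
Proof.
rewrite -hT12 => F.
have Fprop := delta_nbhs_proper ht hsigma.
have cx := delta_quotient_cvg hsigma (@continuous_P_x _ m (sigma T1 t) t).
have cb := delta_quotient_cvg hsigma (@continuous_P_b _ m t t).
split; [by apply/cvg_ex; exists (delta_quotient T1 (P m (sigma T1 t)) t t)
       |by apply/cvg_ex; exists (delta_quotient T1 (P m ^~ t) t t)|].
rewrite /delta_partial_x /delta_partial_b.
rewrite (cvg_lim (@Rhausdorff R) cx) (cvg_lim (@Rhausdorff R) cb).
rewrite /delta_derive /delta_quotient -mulrDl !P_diag; congr (_ / _).
by rewrite addrA subrK.
Qed.
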